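(* Let $k\ge1$, $n\ge k+2$, $w=n-k-2$, and take an equation in $\mathcal{E}_{k+1,n}$ with associated frieze $(d_{i,j})$ and numbers $\alpha_i^j:=d_{i+1,w+i-j+1}$ ($i\in\mathbb{Z}$, $1\le j\le w$). Consider its Gale dual equation $W_i=\alpha_i^1W_{i-1}-\alpha_i^2W_{i-2}+\cdots+(-1)^{w-1}\alpha_i^wW_{i-w}+(-1)^wW_{i-w-1}$. Then (i) all solutions of the Gale dual equation satisfy $W_{i+n}=(-1)^wW_i$ (so the Gale dual equation lies in $\mathcal{E}_{w+1,n}$); (ii) the resulting map $\mathcal{E}_{k+1,n}\to\mathcal{E}_{w+1,n}$ is an involution, i.e. applying the same construction to the Gale dual equation returns the original equation.
   Context: For $m\ge0$, $\mathcal{E}_{m+1,n}$ is the set of difference equations $V_i=a_i^1V_{i-1}-a_i^2V_{i-2}+\cdots+(-1)^{m-1}a_i^mV_{i-m}+(-1)^mV_{i-m-1}$ ($i\in\mathbb{Z}$) with real coefficients $n$-periodic in $i$, such that every solution satisfies $V_{i+n}=(-1)^mV_i$. The frieze associated with an equation in $\mathcal{E}_{k+1,n}$ is the array $d_{i,j}:=V_j$ ($i\in\mathbb{Z}$, $i-k-1\le j\le i+w+k$), where $(V_s)$ is the solution with $V_{i-k-1}=\dots=V_{i-2}=0$, $V_{i-1}=1$. *)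

(* Defs.v *)
From HB Require Import structures.
From mathcomp Require Import all_boot all_order all_algebra.
From mathcomp Require Import boolp classical_sets reals.
From mathcomp Require Import zify.

Set Implicit Arguments.
Unset Strict Implicit.
Unset Printing Implicit Defensive.

Import Order.TTheory GRing.Theory Num.Theory.
Local Open Scope ring_scope.

(* The coefficients of an equation of order m + 1. The upper index, which runs
   over 1..m on paper, is shifted by one: a_i^j is [a i (j - 1)]. *)
Definition coeffs (R : realType) (m : nat) : Type := int -> 'I_m -> R.

Definition is_solution (R : realType) (m : nat) (a : coeffs R m)
    (V : int -> R) : Prop :=
  forall i : int,
    V i = \sum_(j < m) (-1) ^+ j * a i j * V (i - j.+1%:Z)
          + (-1) ^+ m * V (i - m.+1%:Z).

(* Membership in E_{m+1,n}. *)
Definition calE (R : realType) (m n : nat) (a : coeffs R m) : Prop :=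
  (forall (i : int) (j : 'I_m), a (i + n%:Z) j = a i j) /\
  (forall V : int -> R, is_solution a V ->
     forall i : int, V (i + n%:Z) = (-1) ^+ m * V i).

Definition frieze_init (R : realType) (m : nat) (i : int)
    (V : int -> R) : Prop :=
  (forall s : int, i - m.+1%:Z <= s <= i - 2%:Z -> V s = 0) /\
  V (i - 1) = 1.

(* d_{i,j} := V_j for the solution V normalised by [frieze_init]; this V exists
   and is unique (frieze_solution_unique_ex below), so the default value of
   [xget] is never used. The row is kept for all j in Z; the frieze proper is
   its restriction to i-m-1 <= j <= i+w+m. *)
Definition frieze (R : realType) (m : nat) (a : coeffs R m) (i j : int) : R :=
  xget (fun _ : int => 0 : R)
    [set V : int -> R | is_solution a V /\ frieze_init m i V]%classic j.

(* alpha_i^j = d_{i+1,w+i-j+1}, at the paper index j.+1. *)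
Definition gale_dual (R : realType) (k w : nat) (a : coeffs R k) : coeffs R w :=
  fun (i : int) (j : 'I_w) =>
    frieze a (i + 1) (w%:Z + i - j.+1%:Z + 1).
Arguments gale_dual {R k} w a i j.

Section FriezeWellDefined.
Variable R : realType.

Lemma course_of_values (F : nat -> (nat -> R) -> R) :
  (forall p u v, (forall q, (q < p)%N -> u q = v q) -> F p u = F p v) ->
  exists u : nat -> R, forall p, u p = F p u.
Proof.
move=> HF.
pose g := fix g (p : nat) : nat -> R :=
  if p is p'.+1 then fun q => if q == p' then F p' (g p') else g p' q
  else fun=> 0.
have gS p q : (q < p)%N -> g p q = g q.+1 q.
  elim: p => // p IHp; rewrite ltnS leq_eqVlt => /orP[/eqP->//|qp].
  by rewrite [LHS]/= ltn_eqF // IHp.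
exists (fun p => g p.+1 p) => p.
rewrite [LHS]/= eqxx; apply: HF => q qp; exact: gS.
Qed.

Variables (m : nat) (a : coeffs R m).

Lemma is_solution_backward (V : int -> R) (i : int) :
  V i = \sum_(j < m) (-1) ^+ j * a i j * V (i - j.+1%:Z)
          + (-1) ^+ m * V (i - m.+1%:Z) <->
  V (i - m.+1%:Z) = (-1) ^+ m *
     (V i - \sum_(j < m) (-1) ^+ j * a i j * V (i - j.+1%:Z)).
Proof.
split=> H; first by rewrite {1}H addrAC subrr add0r signrMK.
by rewrite H signrMK addrC subrK.
Qed.

Lemma frieze_solution_ex (i : int) :
  exists V : int -> R, is_solution a V /\ frieze_init m i V.
Proof.
pose i0 : int := i - m.+1%:Z.
pose init (p : nat) : R := (p == m)%:R.
have [u Hu] : exists u : nat -> R, forall p, u p =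
    if (p <= m)%N then init p else
    \sum_(j < m) (-1) ^+ j * a (i0 + p%:Z) j * u (p - j.+1)%N
      + (-1) ^+ m * u (p - m.+1)%N.
  apply: (@course_of_values (fun p u => if (p <= m)%N then init p else
    \sum_(j < m) (-1) ^+ j * a (i0 + p%:Z) j * u (p - j.+1)%N
      + (-1) ^+ m * u (p - m.+1)%N)) => p u v uv.
  case: leqP => // mp; congr (_ + _ * _); last by apply: uv; lia.
  by apply: eq_bigr => j _; congr (_ * _); apply: uv; have := ltn_ord j; lia.
have [v Hv] : exists v : nat -> R, forall p, v p =
    if (p <= m)%N then init (m - p)%N else
    (-1) ^+ m * (v (p - m.+1)%N - \sum_(j < m) (-1) ^+ j *
       a (i + m%:Z - p%:Z) j * v (p - m.+1 + j.+1)%N).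
  apply: (@course_of_values (fun p v => if (p <= m)%N then init (m - p)%N else
    (-1) ^+ m * (v (p - m.+1)%N - \sum_(j < m) (-1) ^+ j *
       a (i + m%:Z - p%:Z) j * v (p - m.+1 + j.+1)%N))) => p u1 u2 uv.
  case: leqP => // mp; congr (_ * (_ - _)); first by apply: uv; lia.
  by apply: eq_bigr => j _; congr (_ * _); apply: uv; have := ltn_ord j; lia.
pose V (s : int) : R := if i0 <= s then u (absz (s - i0)%R)
                        else v (absz (i - 1%:Z - s)%R).
have Vu s p : s = i0 + p%:Z -> V s = u p.
  by move=> ->; rewrite /V ifT; [congr u|]; lia.
have Vv s p : s = i - 1 - p%:Z -> V s = v p.
  move=> ->; rewrite /V; case: ifPn => h; last by congr v; lia.
  have pm : (p <= m)%N by rewrite /i0 in h; lia.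
  have -> : absz (i - 1 - p%:Z - i0)%R = (m - p)%N by rewrite /i0; lia.
  by rewrite Hu Hv pm ifT //; lia.
exists V; split; last first.
  split=> [s hs|].
  - rewrite (Vu s (absz (s - i0)%R)); last by rewrite /i0; lia.
    have hp : (absz (s - i0)%R < m)%N by rewrite /i0; lia.
    by rewrite Hu ltnW // /init ltn_eqF.
  - rewrite (Vu _ m); last by rewrite /i0; lia.
    by rewrite Hu leqnn /init eqxx.
move=> s; have [is_|si] := leP i s.
- pose p := absz (s - i0)%R.
  have Ep : s = i0 + p%:Z by rewrite /p /i0; lia.
  have mp : (m < p)%N by rewrite /p /i0; lia.
  rewrite (Vu s p) // Hu leqNgt mp /= -Ep; congr (_ + _ * _).
    apply: eq_bigr => j _; congr (_ * _); symmetry; apply: Vu.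
    by have := ltn_ord j; lia.
  by symmetry; apply: Vu; lia.
apply/is_solution_backward; pose p := absz (i + m%:Z - s)%R.
have Ep : s = i + m%:Z - p%:Z by rewrite /p; lia.
have mp : (m < p)%N by rewrite /p; lia.
rewrite (Vv _ p); last by lia.
rewrite Hv leqNgt mp /= -Ep; congr (_ * (_ - _)).
  by symmetry; apply: Vv; lia.
apply: eq_bigr => j _; congr (_ * _); symmetry; apply: Vv.
by have := ltn_ord j; lia.
Qed.

Lemma solution_window_unique (V V' : int -> R) (i : int) :
  is_solution a V -> is_solution a V' ->
  (forall s, i - m.+1%:Z <= s <= i - 1 -> V s = V' s) -> V = V'.
Proof.
move=> sV sV' VV'.
have H (p : nat) s : i - m.+1%:Z - p%:Z <= s <= i - 1 + p%:Z -> V s = V' s.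
  elim: p s => [|p IHp] s hs; first by apply: VV'; lia.
  have [h|h] := boolP (i - m.+1%:Z - p%:Z <= s <= i - 1 + p%:Z); first exact: IHp.
  have [->|->] : s = i + p%:Z \/ s = i - p.+1%:Z - m.+1%:Z by lia.
  - rewrite sV sV'; congr (_ + _ * _); last by apply: IHp; lia.
    apply: eq_bigr => j _; congr (_ * _); apply: IHp.
    by have := ltn_ord j; lia.
  - rewrite (is_solution_backward V (i - p.+1%:Z)).1 //.
    rewrite (is_solution_backward V' (i - p.+1%:Z)).1 //.
    congr (_ * (_ - _)); first by apply: IHp; lia.
    apply: eq_bigr => j _; congr (_ * _); apply: IHp.
    by have := ltn_ord j; lia.
apply/funext => s; apply: (H (absz (s - i)%R + m.+1)%N); lia.
Qed.

Lemma frieze_solution_unique_ex (i : int) :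
  exists! V : int -> R, is_solution a V /\ frieze_init m i V.
Proof.
have [V [sV [V0 V1]]] := frieze_solution_ex i; exists V; split=> //.
move=> V' [sV' [V'0 V'1]]; apply: (solution_window_unique (i := i)) => // s hs.
have [->|h] := eqVneq s (i - 1); first by rewrite V1 V'1.
by rewrite V0 ?V'0 //; lia.
Qed.

Lemma frieze_spec (i : int) :
  is_solution a (frieze a i) /\ frieze_init m i (frieze a i).
Proof. exact: (xgetPex _ (frieze_solution_ex i)). Qed.

End FriezeWellDefined.

(* Main.v *)
Require Import Defs.
From mathcomp Require Import all_boot all_order all_algebra.
From mathcomp Require Import reals.
From mathcomp Require Import boolp zify ring.

(** Put a_r^0 = a_r^{k+1} = 1, so that the equation reads
    sum_{0 <= l <= k+1} (-1)^l a_r^l V_{r-l} = 0.  For each r let W^{(r)} be the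
    sequence with W_{s+n} = (-1)^w W_s whose values at r+k+1, r+k, ..., r-w are
    a_r^0, ..., a_r^{k+1}, 0, ..., 0.  Since the frieze rows vanish at k
    consecutive places, the dual equation applied to W^{(r)} is a sum over a full
    period of the n-periodic sequence (-1)^s d_{i+1,s+w+1} W_s.  Shifting the
    window to r-w..r+k+1 turns it into the original equation for d_{i+1,.} at r,
    so W^{(r)} solves the dual equation.  As W^{(r)} vanishes at r-w..r-1 and is
    1 at r, it is row r+1 of the dual frieze, which gives the involution; and the
    W^{(r)} span all solutions of the dual equation, which gives its
    antiperiodicity. *)

Set Implicit Arguments.
Unset Strict Implicit.
Unset Printing Implicit Defensive.

Import Order.TTheory GRing.Theory Num.Theory.
Local Open Scope ring_scope.

(** * Window sums and extensions of periodic sequences *)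

Section PeriodicSequences.
Variable R : fieldType.

(** Moving the window by one place exchanges two terms whose arguments differ by [n]. *)
Lemma periodic_window_sum (n : nat) (G : int -> R) :
  (forall x, G (x + n%:Z) = G x) ->
  forall x y : int, \sum_(j < n) G (x - j%:Z) = \sum_(j < n) G (y - j%:Z).
Proof.
move=> Gn.
have step x : \sum_(j < n) G (x + 1 - j%:Z) = \sum_(j < n) G (x - j%:Z).
  case: n Gn => [|n] Gn; first by rewrite !big_ord0.
  rewrite big_ord_recl big_ord_recr /= [LHS]addrC; congr (_ + _).
    by apply: eq_bigr => j _; congr G; rewrite /bump /=; lia.
  by rewrite -[RHS]Gn; congr G; lia.
have steps x (p : nat) :
    \sum_(j < n) G (x + p%:Z - j%:Z) = \sum_(j < n) G (x - j%:Z).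
  elim: p => [|p IHp]; first by rewrite addr0.
  by rewrite -IHp -[RHS]step; apply: eq_bigr => j _; congr G; lia.
move=> x y; have [xy|yx] := leP x y.
  rewrite -(steps x (absz (y - x)%R)).
  by apply: eq_bigr => j _; congr G; lia.
rewrite -(steps y (absz (x - y)%R)).
by apply: eq_bigr => j _; congr G; lia.
Qed.

Lemma antiperiodic_extension (n : nat) (e : R) (x : int) (b : nat -> R) :
  (0 < n)%N -> e != 0 ->
  exists W : int -> R, (forall s, W (s + n%:Z) = e * W s) /\
    (forall p : nat, (p < n)%N -> W (x - p%:Z) = b p).
Proof.
move=> n0 e0.
(* Dividing [x - s] by [n] gives the residue at which [b] is read and the number of periods to undo,
   which may be negative. *)
exists (fun s => e ^ (- ((x - s) %/ n%:Z)%Z) * b (absz ((x - s) %% n%:Z)%Z)).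
split=> [s|p pn].
  have -> : x - s = 1 * n%:Z + (x - (s + n%:Z)) by lia.
  rewrite divzMDl; last by lia.
  by rewrite modzMDl [- (1 + _)]opprD expfzDr // !mulrA mulfV ?mul1r.
have -> : x - (x - p%:Z) = p%:Z by lia.
by rewrite divz_small ?modz_small ?oppr0 ?expr0z ?mul1r //; lia.
Qed.

End PeriodicSequences.

Lemma sum_ord_zero_tail (R : nmodType) (m p : nat) (F : nat -> R) :
  (forall j, (m <= j < m + p)%N -> F j = 0) ->
  \sum_(j < m + p) F j = \sum_(j < m) F j.
Proof.
move=> F0; rewrite big_split_ord /= [X in _ + X]big1 ?addr0 // => j _.
by apply: F0; have := ltn_ord j; lia.
Qed.

(** * Linear recurrences and their frieze rows *)

Section Equations.
Variables (R : realType) (m : nat) (a : coeffs R m).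

(* The paper's a_i^j for 0 <= j <= m + 1, with a_i^0 = a_i^{m+1} = 1. *)
Definition full_coeff (i : int) (j : nat) : R :=
  if j is j'.+1 then oapp (a i) 1 (insub j') else 1.

Arguments full_coeff : simpl never.

Lemma full_coeff0 (i : int) : full_coeff i 0 = 1.
Proof. by []. Qed.

Lemma full_coeffS (i : int) (j : 'I_m) : full_coeff i j.+1 = a i j.
Proof. by rewrite /full_coeff valK. Qed.

Lemma full_coeff_last (i : int) : full_coeff i m.+1 = 1.
Proof. by rewrite /full_coeff insubF // ltnn. Qed.

Lemma is_solution_homogeneous (V : int -> R) :
  is_solution a V <-> forall i,
    \sum_(j < m.+2) (-1) ^+ j * full_coeff i j * V (i - j%:Z) = 0.
Proof.
have E i : \sum_(j < m.+2) (-1) ^+ j * full_coeff i j * V (i - j%:Z) =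
    V i - (\sum_(j < m) (-1) ^+ j * a i j * V (i - j.+1%:Z)
          + (-1) ^+ m * V (i - m.+1%:Z)).
  rewrite big_ord_recl big_ord_recr /= /bump /= !add1n.
  rewrite full_coeff0 full_coeff_last subr0 expr0 !mul1r opprD exprS mulN1r.
  rewrite mulr1 mulNr; congr (_ + (_ + _)).
  rewrite -sumrN; apply: eq_bigr => j _.
  by rewrite add1n full_coeffS exprS !mulN1r !mulNr.
split=> [sV i|sV i]; first by rewrite E -sV subrr.
by apply/eqP; rewrite -subr_eq0 -E sV.
Qed.

Lemma is_solutionD (V V' : int -> R) (c : R) :
  is_solution a V -> is_solution a V' -> is_solution a (fun s => V s + c * V' s).
Proof.
move=> sV sV' i; rewrite sV sV' mulrDr mulr_sumr addrACA -big_split /=.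
by congr (_ + _); [apply: eq_bigr => j _|]; ring.
Qed.

Lemma frieze_eq (i : int) (V : int -> R) :
  is_solution a V -> frieze_init m i V -> frieze a i = V.
Proof.
move=> sV iV; have [sF iF] := frieze_spec a i.
have [U [_ uU]] := frieze_solution_unique_ex a i.
by rewrite -(uU _ (conj sF iF)) -(uU _ (conj sV iV)).
Qed.

(** Row [r + 1] vanishes at the [m] places before [r] and is 1 at [r]. Hence a combination [U] of
    rows can be matched with [V] place by place along a window of length [m + 1], which determines
    the solution. *)
Lemma solution_antiperiodic (n : nat) (e : R) (V : int -> R) :
  (forall i s, frieze a i (s + n%:Z) = e * frieze a i s) ->
  is_solution a V -> forall s, V (s + n%:Z) = e * V s.
Proof.
move=> Fe sV.
have H (p : nat) : (p <= m.+1)%N -> exists U : int -> R, [/\ is_solution a U,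
    forall s, U (s + n%:Z) = e * U s &
    forall s, - m.+1%:Z <= s < p%:Z - m.+1%:Z -> V s = U s].
  elim: p => [_|p IHp pm].
    exists (fun=> 0); split; [|by move=> s; rewrite mulr0|by move=> s hs; lia].
    by move=> i; rewrite mulr0 addr0 big1 // => j _; rewrite mulr0.
  have [U [sU Ue VU]] := IHp (ltnW pm).
  pose r : int := p%:Z - m.+1%:Z.
  have [sF [F0 F1]] := frieze_spec a (r + 1).
  exists (fun s => U s + (V r - U r) * frieze a (r + 1) s); split.
  - exact: is_solutionD.
  - by move=> s; rewrite Ue Fe; ring.
  - move=> s hs; have [->|sr] := eqVneq s r.
      by rewrite -[X in frieze _ _ X](addrK 1 r) F1; ring.
    rewrite F0 ?mulr0 ?addr0; first by apply: VU; lia.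
    by rewrite /r in sr *; lia.
have [U [sU Ue VU]] := H _ (leqnn _).
suff -> : V = U by [].
by apply: (solution_window_unique (i := 0) sV sU) => s hs; apply: VU; lia.
Qed.

End Equations.

(** * Rows of the dual frieze and the involution *)

Section GaleDual.
Variables (R : realType) (k w : nat) (a : coeffs R k).
Let n := (w + k).+2.
Hypothesis ha : calE n a.

Lemma frieze_antiperiodic (i s : int) :
  frieze a i (s + n%:Z) = (-1) ^+ k * frieze a i s.
Proof. by apply: (proj2 ha); case: (frieze_spec a i). Qed.

Lemma frieze_shift (i s : int) : frieze a (i + n%:Z) (s + n%:Z) = frieze a i s.
Proof.
have [sF [F0 F1]] := frieze_spec a (i + n%:Z).
suff -> : frieze a i = fun t => frieze a (i + n%:Z) (t + n%:Z) by [].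
apply: frieze_eq => [t|].
  rewrite /= sF; congr (_ + _ * _); last by congr frieze; lia.
  apply: eq_bigr => j _; rewrite ha.1; congr (_ * _); congr frieze; lia.
split=> [t ht|]; first by apply: F0; lia.
by rewrite -[RHS]F1; congr frieze; lia.
Qed.

(** In the equation at [i - 1 + n] the left side is [(-1) ^+ k], and on the right only the last term
    survives, the others being zeros of the row moved by a period. *)
Lemma frieze_right_boundary (i : int) : frieze a i (i + w%:Z) = 1.
Proof.
have [sF [F0 F1]] := frieze_spec a i.
have := sF (i - 1 + n%:Z); rewrite frieze_antiperiodic F1 mulr1 big1 ?add0r.
  have -> : i - 1 + n%:Z - k.+1%:Z = i + w%:Z by rewrite /n; lia.
  by move/(congr1 ( *%R ((-1) ^+ k))); rewrite signrMK -signr_odd -expr2 sqrr_sign.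
move=> j _; have -> : i - 1 + n%:Z - j.+1%:Z = i - j.+2%:Z + n%:Z by lia.
by rewrite frieze_antiperiodic F0 ?mulr0 //; have := ltn_ord j; lia.
Qed.

(** The two borders of ones of the frieze supply the conventional coefficients at [j = 0] and
    [j = w + 1]. *)
Lemma full_coeff_gale_dual (i : int) (j : nat) : (j <= w.+1)%N ->
  full_coeff (gale_dual w a) i j = frieze a (i + 1) (w%:Z + i + 1 - j%:Z).
Proof.
have [_ [_ F1]] := frieze_spec a (i + 1).
case: j => [_|j jw].
  by rewrite -[LHS](frieze_right_boundary (i + 1)); congr frieze; lia.
have [jw'|wj] := ltnP j w.
  rewrite (full_coeffS (gale_dual w a) i (Ordinal jw')) /gale_dual /=.
  by congr frieze; lia.
have -> : j = w by lia.
by rewrite full_coeff_last -[LHS]F1; congr frieze; lia.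
Qed.

(* The sequence W^{(r)} of the header. *)
Lemma dual_row_ex (r : int) : exists W : int -> R,
  [/\ is_solution (gale_dual w a) W,
      forall s, W (s + n%:Z) = (-1) ^+ w * W s,
      forall j : nat, (j <= k.+1)%N -> W (r + k.+1%:Z - j%:Z) = full_coeff a r j &
      forall s : int, r - w%:Z <= s <= r - 1 -> W s = 0].
Proof.
have [W [We Wb]] := @antiperiodic_extension R n ((-1) ^+ w) (r + k.+1%:Z)
  (fun j => if (j <= k.+1)%N then full_coeff a r j else 0) isT (negbT (signr_eq0 _ _)).
have Wa (j : nat) : (j <= k.+1)%N -> W (r + k.+1%:Z - j%:Z) = full_coeff a r j.
  by move=> jk; rewrite Wb ?jk // /n; lia.
have W0 (s : int) : r - w%:Z <= s <= r - 1 -> W s = 0.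
  move=> hs; have -> : s = r + k.+1%:Z - (absz (r + k.+1%:Z - s)%R)%:Z by lia.
  by rewrite Wb ?ifF // /n; lia.
exists W; split=> //; apply/is_solution_homogeneous => i.
have [sF [F0 F1]] := frieze_spec a (i + 1).
have N1 : (-1 : R) != 0 by rewrite oppr_eq0 oner_neq0.
(* The alternating sign makes the product periodic: [(-1) ^ n] cancels the factors [(-1) ^+ k] and
   [(-1) ^+ w]. *)
pose G (x : int) : R := (-1) ^ x * frieze a (i + 1) (x + w.+1%:Z) * W x.
have Gn x : G (x + n%:Z) = G x.
  rewrite /G We addrAC frieze_antiperiodic expfzDr //.
  have -> : (-1) ^ n%:Z = (-1) ^+ w * (-1) ^+ k :> R.
    by rewrite -[LHS]/((-1) ^+ n) /n -addn2 !exprD sqrrN expr1n mulr1.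
  have sq (p : nat) : (-1) ^+ p * (-1) ^+ p = 1 :> R by rewrite -expr2 sqrr_sign.
  transitivity ((-1) ^ x * frieze a (i + 1) (x + w.+1%:Z) * W x
    * ((-1) ^+ w * (-1) ^+ w) * ((-1) ^+ k * (-1) ^+ k)); first by ring.
  by rewrite !sq !mulr1.
have sgn (x : int) (j : nat) : (-1) ^ (x - j%:Z) = (-1) ^ x * (-1) ^+ j :> R.
  rewrite expfzDr //; congr (_ * _).
  by rewrite -exprz_inv invrN1.
transitivity ((-1) ^ i * \sum_(j < n) G (i - j%:Z)).
  (* The last [k] terms of the period fall on the zeros of row [i + 1]. *)
  have -> : n = (w.+2 + k)%N by rewrite /n; lia.
  rewrite (sum_ord_zero_tail (F := fun j => G (i - j%:Z))); last first.
    by move=> j hj; rewrite /G F0 ?mulr0 ?mul0r //; lia.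
  rewrite mulr_sumr; apply: eq_bigr => j _.
  have hj := ltn_ord j.
  rewrite full_coeff_gale_dual // /G sgn !mulrA.
  have -> : (-1) ^ i * (-1) ^ i = 1 :> R.
    by rewrite -expfzMl mulrNN mulr1 exp1rz.
  by rewrite mul1r; congr (_ * frieze a _ _ * _); lia.
rewrite (periodic_window_sum Gn _ (r + k.+1%:Z)).
have -> : n = (k.+2 + w)%N by rewrite /n; lia.
rewrite (sum_ord_zero_tail (F := fun j => G (r + k.+1%:Z - j%:Z))); last first.
  by move=> j hj; rewrite /G W0 ?mulr0 //; lia.
have /is_solution_homogeneous/(_ r) E := sF.
transitivity ((-1) ^ i * ((-1) ^ (r + k.+1%:Z) * (-1) ^+ k *
  \sum_(j < k.+2) (-1) ^+ j * full_coeff a r j * frieze a (i + 1) (r - j%:Z))).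
  congr (_ * _); rewrite mulr_sumr; apply: eq_bigr => j _.
  have hj := ltn_ord j; rewrite /G sgn Wa //.
  (* The shifts [k + 1] and [w + 1] add up to one full period. *)
  have -> : r + k.+1%:Z - j%:Z + w.+1%:Z = r - j%:Z + n%:Z by rewrite /n; lia.
  by rewrite frieze_antiperiodic; ring.
by rewrite E !mulr0.
Qed.

(** By uniqueness this row is the sequence of [dual_row_ex]; its value 1 at [r] is the last
    coefficient [full_coeff a r k.+1]. *)
Lemma dual_frieze_spec (r : int) :
  (forall s, frieze (gale_dual w a) (r + 1) (s + n%:Z) =
     (-1) ^+ w * frieze (gale_dual w a) (r + 1) s) /\
  (forall j : nat, (j <= k.+1)%N ->
     frieze (gale_dual w a) (r + 1) (r + k.+1%:Z - j%:Z) = full_coeff a r j).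
Proof.
have [W [sW We Wa W0]] := dual_row_ex r.
suff -> : frieze (gale_dual w a) (r + 1) = W by [].
apply: frieze_eq => //; split=> [s hs|]; first by apply: W0; lia.
by rewrite addrK -(full_coeff_last a r) -Wa //; congr W; lia.
Qed.

Lemma gale_dual_calE : calE n (gale_dual w a).
Proof.
split=> [i j|V sV].
  by rewrite /gale_dual -[RHS]frieze_shift; congr frieze; lia.
apply: solution_antiperiodic sV => i s.
by rewrite -[i](subrK 1) (dual_frieze_spec _).1.
Qed.

Lemma gale_dualK : gale_dual k (gale_dual w a) = a.
Proof.
apply/funext => i; apply/funext => j.
rewrite {1}/gale_dual -(full_coeffS a i j) -(dual_frieze_spec i).2.
  by congr frieze; lia.
by have := ltn_ord j; lia.
Qed.

End GaleDual.

Theorem theorem4p2 (R : realType) (k n w : nat)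
    (hk : (1 <= k)%N) (hn : (k + 2 <= n)%N) (hw : w = (n - k - 2)%N)
    (a : coeffs R k) (ha : calE n a) :
  calE n (gale_dual w a) /\ gale_dual k (gale_dual w a) = a.
Proof.
have en : n = (w + k).+2 by lia.
by move: ha; rewrite en => ha'; split; [exact: gale_dual_calE|exact: gale_dualK].
Qed.
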